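(* Let $1\le\ell_1\le\dots\le\ell_r\le n$ and $T=C_r\otimes\cdots\otimes C_1\in B(\varpi_{\ell_r})\otimes\cdots\otimes B(\varpi_{\ell_1})$. (a) If $T$ is not semistandard then $\Psi_T=0$. (b) If $T$ is highest weight, of shape $\lambda=\sum_{i=1}^r\varpi_{\ell_i}$, then $\Psi_T=\mathbf 1_\lambda$. (c) Let $\mu\in(\mathbb Z^n_{\ge0})_+$ with $\ell(\mu)\le\ell_1$ and suppose $T\otimes T^0_\mu$ is semistandard. Let $j\in[n-1]$ with $j\notin C_1$ and $j+1\in C_1$. Then, writing $\Sigma=\sum_{1\le k<r,\ \sigma^j_{C_k}\sigma^j_{C_{k+1}}=-1}\sigma^j_{C_k}(1-t)\Psi_{\Omega^j_k(T)\otimes T^0_\mu}$, $$\Psi_{T\otimes T^0_\mu}=\begin{cases}T_j\,\Psi_{\Omega^j_r(T)\otimes T^0_\mu}+\Sigma, & \text{if } j\in C_r,\ j+1\notin C_r,\\ tT_j^{-1}\,\Psi_{\Omega^j_r(T)\otimes T^0_\mu}+\Sigma, & \text{otherwise.}\end{cases}$$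
   Context: Fix $n\ge1$, $[n]=\{1,\dots,n\}$. $S_n$ is the symmetric group with simple transpositions $s_i=(i,i+1)$ and length function $\ell(\cdot)$. $S_n$ acts on $\mathbb Z^n$ by permuting coordinates; $\varepsilon_1,\dots,\varepsilon_n$ is the standard basis, $\varpi_k=\varepsilon_1+\dots+\varepsilon_k$. $(\mathbb Z^n_{\ge0})_+=\{\lambda\in\mathbb Z^n_{\ge0}:\lambda_1\ge\dots\ge\lambda_n\}$; $\ell(\mu)$ is the number of nonzero parts of $\mu$. For $\lambda\in\mathbb Z^n$, $S_{n,\lambda}=\{w:w\lambda=\lambda\}$. The affine Hecke algebra $H$ is the $\mathbb Z[t^{\pm1}]$-algebra with generators $T_1,\dots,T_{n-1},X_1^{\pm1},\dots,X_n^{\pm1}$ and relations $T_i^2=(t-1)T_i+t$, $T_iT_{i+1}T_i=T_{i+1}T_iT_{i+1}$, $T_iT_j=T_jT_i$ for $|i-j|>1$, $X_iX_j=X_jX_i$, $T_iX_iT_i=tX_{i+1}$, $T_iX_j=X_jT_i$ for $j\notin\{i,i+1\}$ ($tT_i^{-1}=T_i+1-t$). $T_w=T_{i_1}\cdots T_{i_m}$ for a reduced expression $w=s_{i_1}\cdots s_{i_m}$. $H_n$ is the subalgebra generated by the $T_i$ (basis $\{T_w\}_{w\in S_n}$); $H_{n,\lambda}$ is the span of $\{T_w:w\in S_{n,\lambda}\}$, and $\mathbf 1_\lambda=\sum_{w\in S_{n,\lambda}}T_w$. Columns: a column of length $\ell$ is $C=(c_1<\dots<c_\ell)\subseteq[n]$;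 $B(\varpi_\ell)$ is their set. $u_C\in S_n$ sends $k\mapsto c_k$ ($k\le\ell$) and sends $\ell+1,\dots,n$ increasingly onto $[n]\setminus C$. $s_jC$ is the column whose underlying set is the image of $C$ under the transposition $(j,j+1)$. $\sigma^j_C=-1$ if $j\in C$, $j+1\notin C$, and $\sigma^j_C=+1$ otherwise. The column $(1,\dots,\ell)$ is highest weight. Tableaux: for $1\le\ell_1\le\dots\le\ell_r\le n$, $B(\varpi_{\ell_r})\otimes\cdots\otimes B(\varpi_{\ell_1})$ is the set of $T=C_r\otimes\cdots\otimes C_1$, $C_i\in B(\varpi_{\ell_i})$, viewed as a filling of the Young diagram of $\sum\varpi_{\ell_i}$ with columns $C_r,\dots,C_1$ from left to right; $T$ is semistandard if rows weakly increase left to right, and highest weight if all its columns are highest weight. Concatenation $T\otimes T'$ is defined when every column of $T$ is at least as long as every column of $T'$. For $\mu\in(\mathbb Z^n_{\ge0})_+$, $T^0_\mu$ is the tableau of shape $\mu$ all of whose columns are highest weight (row $i$ filled with $i$); $T^0_0$ is empty. For $k\in[r]$, $\Omega^j_k(T)=C_r\otimes\cdots\otimes C_{k+1}\otimes s_jC_k\otimes\cdots\otimes s_jC_1$. Definition of $\Psi$: every $h\in H_n$ is uniquely $h=\sum_{F\in B(\varpi_\ell)}T_{u_F}h_F$ with $h_F\in H_{n,\varpi_\ell}$. For a column $C\in B(\varpi_\ell)$, $\Psi_C=t^{\ell(u_C)}(T_{u_C^{-1}})^{-1}\mathbf 1_{\varpi_\ell}$; for $T=C\otimes S$ with $C\in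 B(\varpi_\ell)$, $S$ a tensor of columns of lengths $\le\ell$, write $\Psi_S=\sum_{E\in B(\varpi_\ell)}T_{u_E}h_{E,S}$ with $h_{E,S}\in H_{n,\varpi_\ell}$, and set $\Psi_T=t^{\ell(u_C)}(T_{u_C^{-1}})^{-1}h_{C,S}$. *)

(* Defs.v *)
From HB Require Import structures.
From mathcomp Require Import all_boot all_order all_algebra.
From mathcomp Require Import fingroup perm.
From Stdlib Require Import ClassicalEpsilon.
Set Implicit Arguments. Unset Strict Implicit. Unset Printing Implicit Defensive.
Import GRing.Theory.
Local Open Scope ring_scope.

(* Conventions: [n] = {1..n} is modelled by 'I_n = {0..n-1} (shift by one);
   s_i (paper, 1<=i<=n-1) is sP n i with 0<=i<n-1, swapping i and i+1.
   Permutations are {perm 'I_n}; composition "a after b" is pc a b. *)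

Section Hecke.
Variable n : nat.
Local Notation perm_n := {perm 'I_n}.

Definition pc (a b : perm_n) : perm_n := (b * a)%g.

(* simple transposition s_i = (i,i+1) (identity if i+1 >= n) *)
Definition sP (i : nat) : perm_n :=
  match (insub i : option 'I_n), (insub i.+1 : option 'I_n) with
  | Some a, Some b => tperm a b
  | _, _ => 1%g
  end.

Definition len (w : perm_n) : nat :=
  #|[set p : 'I_n * 'I_n | (p.1 < p.2)%N && (w p.2 < w p.1)%N]|.

(* a reduced word: repeatedly strip a left descent *)
Fixpoint rwF (k : nat) (w : perm_n) : seq nat :=
  match k with
  | 0 => [::]
  | k'.+1 =>
    match [pick i : 'I_n | (len (pc (sP i) w) < len w)%N] with
    | Some i => (i : nat) :: rwF k' (pc (sP i) w)
    | None => [::]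
    end
  end.
Definition rw (w : perm_n) : seq nat := rwF (len w) w.

Variable R : comUnitRingType.
Variable t : R.

(* H_n as the free R-module with basis {T_w}: coordinates w |-> coeff of T_w *)
Local Notation Hn := {ffun perm_n -> R}.
Definition sc (a : R) (h : Hn) : Hn := [ffun w => a * h w].

Definition bT (w : perm_n) : Hn := [ffun v => (v == w)%:R].

Definition TiT (i : nat) (w : perm_n) : Hn :=
  if (len w < len (pc (sP i) w))%N then bT (pc (sP i) w)
  else sc (t - 1) (bT w) + sc t (bT (pc (sP i) w)).
Definition Ti_act (i : nat) (h : Hn) : Hn := \sum_w sc (h w) (TiT i w).

Definition Tinv_act (i : nat) (h : Hn) : Hn := sc t^-1 (Ti_act i h + sc (1 - t) h).

Definition Tw_act (w : perm_n) (h : Hn) : Hn := foldr Ti_act h (rw w).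

Definition mulH (h h' : Hn) : Hn := \sum_w sc (h w) (Tw_act w h').

Definition TwInv (w : perm_n) : Hn := foldl (fun acc i => Tinv_act i acc) (bT 1%g) (rw w).

Definition stab (lam : 'I_n -> nat) (w : perm_n) : bool := [forall i, lam (w i) == lam i].
Definition one_ (lam : 'I_n -> nat) : Hn := \sum_(w | stab lam w) bT w.
Definition inHpar (lam : 'I_n -> nat) (h : Hn) : Prop := forall w, h w != 0 -> stab lam w.

Definition varpi (l : nat) : 'I_n -> nat := fun i => (i < l)%N.

Definition colL (C : {set 'I_n}) : seq 'I_n := enum C ++ enum (~: C).

Lemma colL_inj (C : {set 'I_n}) : injective (fun k : 'I_n => nth k (colL C) k).
Proof.
have sz : size (colL C) = n.
  by rewrite size_cat -!cardE cardsC card_ord.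
have uq : uniq (colL C).
  rewrite cat_uniq !enum_uniq /= andbT; apply/hasPn => x.
  by rewrite !mem_enum in_setC => ->.
move=> k1 k2 /eqP; rewrite (set_nth_default k1 k2) ?sz ?ltn_ord //.
by rewrite nth_uniq ?sz ?ltn_ord // => /eqP /val_inj.
Qed.

Definition uC (C : {set 'I_n}) : perm_n := perm (@colL_inj C).

(* decomposition h = sum_{F in B(varpi_l)} T_{u_F} h_F, h_F in H_{n,varpi_l};
   hcomp l h F is the (unique) component h_F *)
Definition decomp (l : nat) (h : Hn) (f : {set 'I_n} -> Hn) : Prop :=
  (forall F, inHpar (varpi l) (f F)) /\
  h = \sum_(F : {set 'I_n} | #|F| == l) mulH (bT (uC F)) (f F).
Definition hcomp (l : nat) (h : Hn) : {set 'I_n} -> Hn :=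
  epsilon (inhabits (fun _ => 0)) (decomp l h).

Definition tTinvU (C : {set 'I_n}) : Hn := sc (t ^+ len (uC C)) (TwInv (uC C)^-1).

(* tableaux: T = C_r (x) ... (x) C_1 is the list [:: C_r; ...; C_1]
   (columns from left to right) *)
Definition Psi_col (C : {set 'I_n}) : Hn := mulH (tTinvU C) (one_ (varpi #|C|)).
Fixpoint Psi (T : seq {set 'I_n}) : Hn :=
  match T with
  | [::] => bT 1%g (* not used: Psi of the empty tableau is not defined in the paper *)
  | C :: Sr =>
    match Sr with
    | [::] => Psi_col C
    | _ :: _ => mulH (tTinvU C) (hcomp #|C| (Psi Sr) C)
    end
  end.
End Hecke.

Section Tableaux.
Variable n : nat.

Definition is_tensor (T : seq {set 'I_n}) : bool :=
  (0 < size T)%N && all (fun C : {set 'I_n} => 0 < #|C|)%N T &&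
  sorted (fun D E : {set 'I_n} => #|E| <= #|D|)%N T.

(* k-th entry (0-based, from the top) of a column *)
Definition entry (C : {set 'I_n}) (k : nat) : nat := nth 0%N [seq val x | x <- enum C] k.

Definition semistandard (T : seq {set 'I_n}) : bool :=
  sorted (fun D E : {set 'I_n} => [forall k : 'I_n, (k < #|E|)%N ==> (entry D k <= entry E k)%N]) T.

Definition hw_col (l : nat) : {set 'I_n} := [set i : 'I_n | (i < l)%N].
Definition is_hw_col (C : {set 'I_n}) : bool := C == hw_col #|C|.
Definition highest_weight (T : seq {set 'I_n}) : bool := all is_hw_col T.

Definition tshape (T : seq {set 'I_n}) : 'I_n -> nat :=
  fun i => count (fun C : {set 'I_n} => i < #|C|)%N T.

Definition dominant (mu : 'I_n -> nat) : bool :=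
  [forall i : 'I_n, forall j : 'I_n, (i <= j)%N ==> (mu j <= mu i)%N].
Definition plen (mu : 'I_n -> nat) : nat := #|[set i | mu i != 0%N]|.
Definition conj_part (mu : 'I_n -> nat) (c : nat) : nat := #|[set i | (c <= mu i)%N]|.
Definition T0 (mu : 'I_n -> nat) : seq {set 'I_n} :=
  [seq hw_col (conj_part mu c) | c <- iota 1 (\max_i mu i)].

Definition inC (C : {set 'I_n}) (m : nat) : bool := [exists x in C, val x == m].
Definition sigb (j : nat) (C : {set 'I_n}) : bool := inC C j && ~~ inC C j.+1.
Definition sigma (R : ringType) (j : nat) (C : {set 'I_n}) : R := (-1) ^+ sigb j C.

Definition sC (j : nat) (C : {set 'I_n}) : {set 'I_n} := sP n j @: C.

(* C_k (k = 1..r) of T = [:: C_r; ...; C_1] *)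
Definition colk (T : seq {set 'I_n}) (k : nat) : {set 'I_n} := nth set0 T (size T - k).

Definition Omega (j k : nat) (T : seq {set 'I_n}) : seq {set 'I_n} :=
  take (size T - k) T ++ map (sC j) (drop (size T - k) T).
End Tableaux.

(* Main.v *)
(* Right multiplications by the [T_c] commute with the action of the [T_a], so an operator
   commuting with them is determined by its value at [1]; hence [T_w] does not depend
   on the reduced word chosen for [w]. Modulo the stabilizer of [varpi_l], the component
   [h_F] of [h] is read off the coefficients of [h] on the coset of [u_F], which makes
   [Psi_S |-> Psi_(C (x) S)] an explicit linear operator [Kop C].
   (a) [t^len(u_D) T_(u_D^-1)^-1 H_(varpi_m)] is supported on the [w] whose first [m] values,
   once sorted, are bounded entrywise by [D]; if such a [w] lies in the coset of [u_C] then
   [C (x) D] is semistandard.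
   (b) A permutation fixes a sum of dominant weights iff it fixes each of them.
   (c) Induction on the number of columns: [Kop C] intertwines [T_j] or [t T_j^-1] on both
   sides up to the term of [Sigma] coming from [C] and its right neighbour. The first
   column costs nothing because semistandardness forces [s_j] to fix [mu]. *)
Require Import Defs.
From HB Require Import structures.
From mathcomp Require Import all_boot all_order all_algebra.
From mathcomp Require Import fingroup perm.
From mathcomp Require Import zify ring.
From Stdlib Require Import Classical_Prop ClassicalEpsilon.
Set Implicit Arguments. Unset Strict Implicit. Unset Printing Implicit Defensive.
Import GRing.Theory.
Local Open Scope ring_scope.

Local Ltac coord := apply/ffunP => ?; rewrite !ffunE.

(** * Inversions, descents and reduced words in the symmetric group *)

Section Permutations.
Variable n : nat.
Local Notation perm_n := {perm 'I_n}.
Implicit Types (a b c d x y : 'I_n) (u v w : perm_n) (C D E F : {set 'I_n}).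

Lemma sPE a b : b = a.+1 :> nat -> sP n a = tperm a b.
Proof.
move=> ab; rewrite /sP -ab !insubT //= => ha hb.
by congr tperm; apply: val_inj.
Qed.

Lemma tperm_adj_lt a b x y : b = a.+1 :> nat ->
  ~ (x = a /\ y = b) -> ~ (x = b /\ y = a) ->
  (tperm a b x < tperm a b y)%N = (x < y)%N.
Proof.
move=> ab h1 h2.
have E (p q : 'I_n) : p <> q -> (p : nat) <> q by move=> h /val_inj.
case: tpermP => [xa|xb|/E xa /E xb]; case: tpermP => [ya|yb|/E ya /E yb]; subst; try lia.
  by case: h1.
by case: h2.
Qed.

Lemma tperm_adj_ltn_bound a b x (k : nat) : b = a.+1 :> nat -> k <> b ->
  (tperm a b x < k)%N = (x < k)%N.
Proof. by move=> ab kb; case: tpermP => [->|->|_ _] //; lia. Qed.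

Lemma ltNge_perm w a b : b = a.+1 :> nat ->
  (w b < w a)%N = ~~ (w a < w b)%N.
Proof.
move=> ab; rewrite -leqNgt [RHS]leq_eqVlt; case: eqP => [/ord_inj/perm_inj E|_ //].
by move: ab; rewrite E => /n_Sn.
Qed.

(** Exchanging the adjacent values [a] and [b] alters the relative order of no other pair of values,
    so the inversion set gains exactly the pair of positions of [a] and [b]. *)
Lemma len_asc a b w : b = a.+1 :> nat -> (w^-1%g a < w^-1%g b)%N ->
  len (pc (sP n a) w) = (len w).+1.
Proof.
move=> ab asc; rewrite (sPE ab) /len /pc.
set A := finset _; set B := finset _.
have -> : A = (w^-1%g a, w^-1%g b) |: B.
  apply/setP => -[p q]; rewrite !inE /= !permM xpair_eqE.
  case: (altP (p =P w^-1%g a)) => [->|pa]; case: (altP (q =P w^-1%g b)) => [->|qb] /=.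
  - by rewrite asc !permKV tpermL tpermR; lia.
  - rewrite permKV tperm_adj_lt //; first by case=> _ E; move: ab; rewrite E; lia.
    by case=> /(congr1 (w^-1%g)); rewrite permK => E; move: qb; rewrite E eqxx.
  - rewrite permKV tperm_adj_lt //; first by case=> E; move: ab; rewrite E; lia.
    by case=> _ /(congr1 (w^-1%g)); rewrite permK => E; move: pa; rewrite E eqxx.
  - case: (ltnP p q) => //= pq; rewrite tperm_adj_lt //.
    + case=> /(congr1 (w^-1%g)); rewrite permK => Eq /(congr1 (w^-1%g)); rewrite permK => Ep.
      by move: asc; rewrite -Ep -Eq; lia.
    + by case=> /(congr1 (w^-1%g)); rewrite permK => Eq; move: qb; rewrite Eq eqxx.
by rewrite cardsU1 !inE /= !permKV asc ab ltnNge leqnSn.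
Qed.

Lemma pc_sPK a w : pc (sP n a) (pc (sP n a) w) = w.
Proof.
rewrite /pc -mulgA; suff -> : (sP n a * sP n a)%g = 1%g by rewrite mulg1.
rewrite /sP; case: (insub (nat_of_ord a)) => [p|]; last by rewrite mulg1.
by case: (insub a.+1) => [q|]; rewrite ?tperm2 ?mulg1.
Qed.

Lemma inv_pc_sP a b w : b = a.+1 :> nat ->
  ((pc (sP n a) w)^-1 a = w^-1 b)%g /\ ((pc (sP n a) w)^-1 b = w^-1 a)%g.
Proof.
by move=> ab; rewrite (sPE ab) /pc invMg tpermV !permM tpermL tpermR.
Qed.

Lemma len_desc a b w : b = a.+1 :> nat -> ~~ (w^-1%g a < w^-1%g b)%N ->
  len w = (len (pc (sP n a) w)).+1.
Proof.
move=> ab; rewrite -ltNge_perm // => desc.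
by rewrite -(len_asc ab) ?pc_sPK //; have [-> ->] := inv_pc_sP w ab.
Qed.

Lemma len_lt_asc a b w : b = a.+1 :> nat ->
  (len w < len (pc (sP n a) w))%N = (w^-1%g a < w^-1%g b)%N.
Proof.
move=> ab; case: (boolP (w^-1%g a < _)%N) => h; first by rewrite (len_asc ab h) ltnS leqnn.
by have := len_desc ab h; lia.
Qed.

(** Inversions of [w^-1] become inversions of [w] by taking the two preimages in the opposite
    order. *)
Lemma len_inv w : len w^-1%g = len w.
Proof.
rewrite /len -(card_imset _ (f := fun p : 'I_n * 'I_n => (w^-1%g p.2, w^-1%g p.1))); last first.
  by move=> [p q] [p' q'] [] /perm_inj -> /perm_inj ->.
apply: eq_card => -[p q]; rewrite !inE; apply/imsetP/idP => /=.
  by case=> -[x y]; rewrite inE /= => /andP[xy yx] [-> ->]; rewrite !permKV yx.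
move=> /andP[pq qp]; exists (w q, w p); rewrite ?inE /= ?permK //.
by rewrite qp.
Qed.

Lemma incr_perm_bound w : (forall x y, (x < y -> w x < w y)%N) -> forall x, (x <= w x)%N.
Proof.
move=> inc x; case: x => m; elim: m => //= m IH hm.
have hm' : (m < n)%N by lia.
exact: leq_ltn_trans (IH hm') (inc (Ordinal hm') (Ordinal hm) (ltnSn m)).
Qed.

Lemma incr_perm1 w : (forall x y, (x < y -> w x < w y)%N) -> w = 1%g.
Proof.
move=> inc.
have incV x y : (x < y -> w^-1%g x < w^-1%g y)%N.
  move=> xy; rewrite ltnNge; apply/negP; rewrite leq_eqVlt => /orP[/eqP/ord_inj/perm_inj E|/inc].
    by move: xy; rewrite E ltnn.
  by rewrite !permKV; lia.
apply/permP => x; rewrite perm1; apply/val_inj/eqP; rewrite eqn_leq incr_perm_bound // andbT.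
by have := incr_perm_bound incV (w x); rewrite permK.
Qed.

Lemma adj_incr_perm1 w : (forall a b, b = a.+1 :> nat -> (w a < w b)%N) -> w = 1%g.
Proof.
move=> inc; apply: incr_perm1 => x y xy.
have [m] : exists m, (y : nat) = (x + m.+1)%N by exists (y - x).-1; lia.
elim: m y {xy} => [|m IH] y Ey; first by apply: inc; lia.
have hy : (x + m.+1 < n)%N by have := ltn_ord y; lia.
by apply: ltn_trans (IH (Ordinal hy) erefl) (inc _ _ _); rewrite Ey /= addnS.
Qed.

(** Lets inductions on length follow the chosen reduced word without unfolding [rwF]. *)
Variant rw_spec w : seq nat -> Type :=
  | RwNil of w = 1%g : rw_spec w [::]
  | RwCons a b of b = a.+1 :> nat & (w^-1%g b < w^-1%g a)%N
      & len w = (len (pc (sP n a) w)).+1 : rw_spec w (nat_of_ord a :: rw (pc (sP n a) w)).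

Lemma descent_ex w : w <> 1%g -> exists a b, b = a.+1 :> nat /\ (w^-1%g b < w^-1%g a)%N.
Proof.
move=> w1; apply: NNPP => none; apply: w1; apply: invg_inj; rewrite invg1.
apply: adj_incr_perm1 => a b ab; rewrite -[X in is_true X]negbK -ltNge_perm //.
by apply/negP => h; apply: none; exists a, b.
Qed.

(** At the last index [sP] is the identity, so a strict drop in length guarantees that [a] has a
    successor in ['I_n]. *)
Lemma len_lt_adj (a : 'I_n) w : (len (pc (sP n a) w) < len w)%N ->
  {b : 'I_n | b = a.+1 :> nat & (w^-1%g b < w^-1%g a)%N}.
Proof.
case: (ltnP a.+1 n) => [h|h] lt.
  have ab : Ordinal h = a.+1 :> nat by [].
  exists (Ordinal h) => //; rewrite (ltNge_perm _ ab); apply/negP => asc.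
  by move: lt; rewrite (len_asc ab asc); lia.
move: lt; rewrite /sP insubT //= => lt.
by rewrite insubF ?(negbTE _) /pc ?mulg1 ?ltnn //; apply/negbTE; rewrite -leqNgt.
Qed.

Lemma rwP w : rw_spec w (rw w).
Proof.
rewrite /rw; case E : (len w) => [|k] /=.
  apply: RwNil; apply: NNPP => /descent_ex [a [b [ab h]]].
  by move: E; rewrite (len_desc ab) // -(ltNge_perm _ ab).
case: pickP => [a lt|none].
  have [b ab desc] := len_lt_adj lt.
  have E' : len w = (len (pc (sP n a) w)).+1.
    by apply: (len_desc ab); rewrite -(ltNge_perm _ ab).
  have -> : k = len (pc (sP n a) w) by move: E'; rewrite E; case.
  exact: RwCons ab desc E'.
apply: RwNil; apply: NNPP => /descent_ex [a [b [ab h]]].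
by have := none a; rewrite [X in (_ < X)%N](len_desc ab) ?ltnSn // -(ltNge_perm _ ab).
Qed.

End Permutations.

(** * Left and right multiplication in the Hecke algebra, and inverses of the [T_w] *)

Section HeckeOperators.
Variables (n : nat) (R : comUnitRingType) (t : R).
Local Notation perm_n := {perm 'I_n}.
Local Notation Hn := {ffun perm_n -> R}.
Local Notation T_ := (@Ti_act n R t).
Implicit Types (a b c d x y : 'I_n) (u v w : perm_n) (h g : Hn) (f : Hn -> Hn).

(** Only the basis elements at [w] and [s_a w] contribute to the coefficient at [w]; which branch
    applies depends on whether [a] precedes [b] in [w]. *)
Lemma Ti_actE a b h w : b = a.+1 :> nat ->
  T_ a h w = if (w^-1%g a < w^-1%g b)%N then t * h (pc (sP n a) w)
             else h (pc (sP n a) w) + (t - 1) * h w.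
Proof.
move=> ab; rewrite /Ti_act sum_ffunE.
have E v : sc (h v) (TiT t a v) w =
    (if v == w then h v * (if (v^-1%g a < v^-1%g b)%N then 0 else t - 1) else 0) +
    (if v == pc (sP n a) w then h v * (if (v^-1%g a < v^-1%g b)%N then 1 else t) else 0).
  rewrite ffunE /TiT (len_lt_asc _ ab).
  have -> : (v == pc (sP n a) w) = (w == pc (sP n a) v).
    by apply/eqP/eqP => ->; rewrite pc_sPK.
  rewrite (eq_sym v w); case: ifP => _; rewrite !ffunE.
    by case: eqP; case: eqP => /= *; ring.
  by case: eqP; case: eqP => /= *; ring.
rewrite (eq_bigr _ (fun v _ => E v)) big_split /= -!big_mkcond !big_pred1_eq.
have [-> ->] := inv_pc_sP w ab; rewrite (ltNge_perm _ ab).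
by case: (_ < _)%N => /=; ring.
Qed.

(* Right multiplication by [T_c]. *)
Definition Ri c d h : Hn :=
  [ffun w : perm_n => if (w c < w d)%N then t * h (tperm c d * w)%g
                      else h (tperm c d * w)%g + (t - 1) * h w].

(** One operator permutes values and the other positions. They interact only if [w] maps the pair
    [c], [d] onto the pair [a], [b], and then [s_a w = w s_c]; otherwise neither one changes the
    order test of the other. *)
Lemma Ti_act_Ri a b c d h : b = a.+1 :> nat -> d = c.+1 :> nat ->
  T_ a (Ri c d h) = Ri c d (T_ a h).
Proof.
move=> ab cd; apply/ffunP => w; rewrite (Ti_actE _ _ ab) !ffunE !(Ti_actE _ _ ab) (sPE ab) /pc.
rewrite !mulgA !invMg tpermV !permM.
have [/orP S|/norP[/andP S1 /andP S2]] :=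
  boolP ((w c == a) && (w d == b) || (w c == b) && (w d == a)).
  have -> : (tperm c d * w = w * tperm a b)%g.
    have -> : tperm a b = tperm (w c) (w d).
      by case: S => /andP[/eqP-> /eqP->]; rewrite // tpermC.
    by rewrite -tpermJ /conjg !mulgA mulgV mul1g.
  rewrite -!mulgA !tperm2 !mulg1.
  by case: S => /andP[/eqP Ec /eqP Ed]; rewrite -Ec -Ed !permK !tpermL !tpermR Ec Ed ab cd
    ?ltnSn ?[(_.+2 <= _)%N]ltnNge ?leqnSn /=; ring.
rewrite !(tperm_adj_lt ab) ?(tperm_adj_lt cd).
- by do 2 case: (_ < _)%N; ring.
- by case=> Ec Ed; case: S1; rewrite -Ec -Ed !permKV !eqxx.
- by case=> Ed Ec; case: S2; rewrite -Ec -Ed !permKV !eqxx.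
- by case=> Ec Ed; case: S1; rewrite Ec Ed !eqxx.
- by case=> Ec Ed; case: S2; rewrite Ec Ed !eqxx.
Qed.

Definition lin f := forall (r : R) h g, f (sc r h + g) = sc r (f h) + f g.

Lemma lin0 f : lin f -> f 0 = 0.
Proof.
move=> lf; have /(congr1 (fun h => h - f 0)) := lf 1 0 0.
have -> : sc 1 0 + 0 = 0 :> Hn by coord; ring.
have -> : sc 1 (f 0) = f 0 by coord; ring.
by rewrite addrK subrr.
Qed.

Lemma linD f h g : lin f -> f (h + g) = f h + f g.
Proof.
have sc1 k : sc 1 k = k :> Hn by coord; ring.
by move=> lf; have := lf 1 h g; rewrite !sc1.
Qed.

Lemma linZ f r h : lin f -> f (sc r h) = sc r (f h).
Proof. by move=> lf; have := lf r h 0; rewrite (lin0 lf) !addr0. Qed.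

Lemma lin_sum f (I : Type) (s : seq I) (P : pred I) (F : I -> Hn) :
  lin f -> f (\sum_(i <- s | P i) F i) = \sum_(i <- s | P i) f (F i).
Proof.
by move=> lf; apply: (big_morph f) => [h g|]; [exact: linD | exact: lin0].
Qed.

Lemma basis_expand h : h = \sum_w sc (h w) (bT R w).
Proof.
apply/ffunP => v; rewrite sum_ffunE (bigD1 v) //= big1 ?addr0 ?ffunE ?eqxx ?mulr1 //.
by move=> w wv; rewrite !ffunE eq_sym (negbTE wv) mulr0.
Qed.

Lemma lin_ext f1 f2 : lin f1 -> lin f2 -> (forall w, f1 (bT R w) = f2 (bT R w)) -> f1 =1 f2.
Proof.
move=> l1 l2 E h; rewrite [h]basis_expand !lin_sum //.
by apply: eq_bigr => w _; rewrite !linZ // E.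
Qed.

Lemma lin_comp f1 f2 : lin f1 -> lin f2 -> lin (f1 \o f2).
Proof. by move=> l1 l2 r h g /=; rewrite l2 l1. Qed.

Lemma lin_sc r : lin (@sc n R r).
Proof. by move=> r' h g; coord; ring. Qed.

Lemma lin_add f1 f2 : lin f1 -> lin f2 -> lin (fun h => f1 h + f2 h).
Proof. by move=> l1 l2 r h g; rewrite l1 l2; coord; ring. Qed.

Lemma lin_Ti i : lin (T_ i).
Proof.
move=> r h g; rewrite /Ti_act; apply/ffunP => v; rewrite !ffunE !sum_ffunE mulr_sumr -big_split.
by apply: eq_bigr => w _; rewrite !ffunE /=; ring.
Qed.

Lemma lin_Ri c d : lin (Ri c d).
Proof. by move=> r h g; coord; case: ifP => _; ring. Qed.

(* Operators commuting with right multiplications: by [mulH_leftop] they are the left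
   multiplications. [leftop_ext] replaces the independence of [T_w] of the choice of a
   reduced word. *)
Definition leftop f :=
  lin f /\ forall c d, d = c.+1 :> nat -> forall h, f (Ri c d h) = Ri c d (f h).

Lemma leftop_comp f1 f2 : leftop f1 -> leftop f2 -> leftop (f1 \o f2).
Proof.
move=> [l1 c1] [l2 c2]; split=> [|c d cd h /=]; first exact: lin_comp.
by rewrite c2 // c1.
Qed.

Lemma leftop_sc r : leftop (@sc n R r).
Proof. by split=> [|c d cd h]; [exact: lin_sc | rewrite (linZ _ _ (@lin_Ri c d))]. Qed.

Lemma leftop_add f1 f2 : leftop f1 -> leftop f2 -> leftop (fun h => f1 h + f2 h).
Proof.
move=> [l1 c1] [l2 c2]; split=> [|c d cd h /=]; first exact: lin_add.
by rewrite c1 // c2 // (linD _ _ (@lin_Ri c d)).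
Qed.

Lemma leftop_Ti a b : b = a.+1 :> nat -> leftop (T_ a).
Proof. by move=> ab; split=> [|c d cd h]; [exact: lin_Ti | exact: Ti_act_Ri ab cd]. Qed.

Lemma leftop_Tinv a b : b = a.+1 :> nat -> leftop (Tinv_act t a).
Proof.
move=> ab; apply: (leftop_comp (leftop_sc _) (leftop_add (leftop_Ti ab) (leftop_sc _))).
Qed.

Lemma Ri_bT c d w : d = c.+1 :> nat -> (w c < w d)%N ->
  Ri c d (bT R w) = bT R (tperm c d * w)%g.
Proof.
move=> cd asc; apply/ffunP => v; rewrite !ffunE.
have E u : (tperm c d * u == w)%g = (u == tperm c d * w)%g.
  by apply/eqP/eqP => [<-|->]; rewrite mulgA tperm2 mul1g.
rewrite E; case: (v =P (tperm c d * w)%g) => [->|Nv] /=.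
  rewrite !permM tpermL tpermR ltnNge (ltnW asc) /=.
  case: eqP => [Ew|_] /=; last by ring.
  by move: asc; rewrite -{1}Ew permM tpermL ltnn.
case: ifP => [_|asc']; first by ring.
by case: eqP => [Ew|_] /=; [move: asc'; rewrite Ew asc | ring].
Qed.

(** Each [T_w] is reached from the unit by right multiplications. The induction is on the length of
    [w^-1], whose left descents are the right descents of [w]. *)
Lemma leftop_ext f1 f2 : leftop f1 -> leftop f2 -> f1 (bT R 1%g) = f2 (bT R 1%g) -> f1 =1 f2.
Proof.
move=> [l1 c1] [l2 c2] E; apply: lin_ext => // w.
move k: (len w^-1%g) => m; elim: m w k => [|m IH] w k.
all: case: (w =P 1%g) => [-> //|w1].
all: have [a [b [ab desc]]] : exists a b, b = a.+1 :> nat /\ (w b < w a)%N.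
1,3: by have /descent_ex := (fun E => w1 (@invg_inj _ w 1%g (etrans E (esym (invg1 _)))));
       rewrite invgK.
all: have desc' : ~~ (w^-1^-1 a < w^-1^-1 b)%g%N by rewrite invgK -(ltNge_perm _ ab).
  by move: k; rewrite (len_desc ab desc').
have -> : bT R w = Ri a b (bT R (tperm a b * w)%g).
  by rewrite Ri_bT ?mulgA ?tperm2 ?mul1g // !permM tpermL tpermR.
rewrite c1 // c2 // IH //; rewrite invMg tpermV.
by move: k; rewrite (len_desc ab desc') (sPE ab) => -[].
Qed.

Lemma Ti_bT a b w : b = a.+1 :> nat -> (w^-1%g a < w^-1%g b)%N ->
  T_ a (bT R w) = bT R (pc (sP n a) w).
Proof.
move=> ab asc; apply/ffunP => v; rewrite (Ti_actE _ _ ab) !ffunE.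
have -> : (pc (sP n a) v == w) = (v == pc (sP n a) w).
  by apply/eqP/eqP => [<-|->]; rewrite pc_sPK.
case: (v =P pc (sP n a) w) => [->|Nv] /=.
  have [-> ->] := inv_pc_sP w ab; rewrite ltnNge (ltnW asc) /=.
  case: eqP => [Ew|_] /=; last by ring.
  by have [E _] := inv_pc_sP w ab; move: asc; rewrite -E Ew ltnn.
case: ifP => [_|asc']; first by ring.
by case: eqP => [Ew|_] /=; [move: asc'; rewrite Ew asc | ring].
Qed.

Lemma Ti_sqr a b h : b = a.+1 :> nat -> T_ a (T_ a h) = sc (t - 1) (T_ a h) + sc t h.
Proof.
move=> ab; apply/ffunP => w; rewrite !ffunE !(Ti_actE _ _ ab) pc_sPK.
have [-> ->] := inv_pc_sP w ab; rewrite (ltNge_perm _ ab).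
by case: (_ < _)%N => /=; ring.
Qed.

Lemma lin_mulH g : lin (mulH t g).
Proof.
move=> r h k; rewrite /mulH.
have lw w : lin (Tw_act t w).
  by rewrite /Tw_act; elim: (rw w) => [|i s IH] // r' h' g' /=; rewrite IH lin_Ti.
apply/ffunP => v; rewrite !ffunE !sum_ffunE mulr_sumr -big_split.
by apply: eq_bigr => w _; rewrite lw !ffunE /=; ring.
Qed.

Lemma Tw_act1 h : Tw_act t 1%g h = h.
Proof.
rewrite /Tw_act; case: rwP => // a b ab.
by rewrite invg1 !perm1 ab ltnNge leqnSn.
Qed.

Lemma leftop_Tw w : leftop (Tw_act t w).
Proof.
move k: (len w) => m; elim: m w k => [|m IH] w; rewrite /Tw_act; case: rwP => [_ _|a b ab _ ->] //.
by move=> [/IH]; apply: leftop_comp; apply: leftop_Ti ab.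
Qed.

Lemma Tw_act_bT1 w : Tw_act t w (bT R 1%g) = bT R w.
Proof.
move k: (len w) => m; elim: m w k => [|m IH] w; rewrite /Tw_act; case: rwP => [->|a b ab desc ->] //.
move=> [/IH E] /=; rewrite -/(Tw_act _ _ _) E (Ti_bT ab) ?pc_sPK //.
by have [-> ->] := inv_pc_sP w ab.
Qed.

Lemma leftop_mulH g : leftop (mulH t g).
Proof.
split=> [|c d cd h]; first exact: lin_mulH.
rewrite /mulH (lin_sum _ _ _ (@lin_Ri c d)); apply: eq_bigr => w _.
by rewrite (linZ _ _ (@lin_Ri c d)); have [_ ->] := leftop_Tw w.
Qed.

(** Both sides are left operators with the same value at the unit. This trades the products in the
    definition of [Psi] for operators. *)
Lemma mulH_leftop f h : leftop f -> mulH t (f (bT R 1%g)) h = f h.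
Proof.
move=> lf; apply: leftop_ext => //; first exact: leftop_mulH.
rewrite /mulH [RHS]basis_expand.
by apply: eq_bigr => w _; rewrite Tw_act_bT1.
Qed.

(** Frees [Tw_act] from the particular descent picked by [rw]: any left ascent may be added, since
    both sides agree at the unit. *)
Lemma Tw_act_asc a b w h : b = a.+1 :> nat -> (w^-1%g a < w^-1%g b)%N ->
  Tw_act t (pc (sP n a) w) h = T_ a (Tw_act t w h).
Proof.
move=> ab asc; apply: (leftop_ext _ (leftop_comp (leftop_Ti ab) (leftop_Tw w))).
  exact: leftop_Tw.
by rewrite /= !Tw_act_bT1 (Ti_bT ab).
Qed.

Lemma Tw_act_rasc a b w h : b = a.+1 :> nat -> (w a < w b)%N ->
  Tw_act t (pc w (sP n a)) h = Tw_act t w (T_ a h).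
Proof.
move=> ab asc; apply: (leftop_ext _ (leftop_comp (leftop_Tw w) (leftop_Ti ab))).
  exact: leftop_Tw.
rewrite /= Tw_act_bT1 (Ti_bT ab) ?invg1 ?perm1 ?ab //.
(* At the unit, left multiplication by [T_a] is also right multiplication by [T_a], which can be
   pulled out of [Tw_act t w]. *)
have -> : bT R (pc (sP n a) 1%g) = Ri a b (bT R 1%g).
  by rewrite Ri_bT ?perm1 ?ab // (sPE ab) /pc mul1g mulg1.
by have [_ ->] := leftop_Tw w; rewrite // Tw_act_bT1 (Ri_bT ab) // (sPE ab).
Qed.

(** The operator form of [TwInv]: [foldl] cancels the leftmost letter of the word first, as an
    inverse of [Tw_act] must. *)
Definition Tw_inv w h := foldl (fun k i => Tinv_act t i k) h (rw w).

Lemma leftop_Tw_inv w : leftop (Tw_inv w).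
Proof.
move k: (len w) => m; elim: m w k => [|m IH] w; rewrite /Tw_inv; case: rwP => [_ _|a b ab _ ->] //=.
by move=> [/IH l]; apply: (leftop_comp l (leftop_Tinv ab)).
Qed.

(* [Tbar a = t T_a^-1] and [Tb w = t^(len w) (T_(w^-1))^-1], so that [Tb w] is the
   product of the [Tbar a] along a reduced word of [w]. *)
Definition Tbar (i : nat) h := T_ i h + sc (1 - t) h.
Definition Tb w h := sc (t ^+ len w) (Tw_inv w^-1%g h).

Lemma leftop_Tbar a b : b = a.+1 :> nat -> leftop (Tbar a).
Proof. move=> ab; exact: (leftop_add (leftop_Ti ab) (leftop_sc _)). Qed.

Lemma leftop_Tb w : leftop (Tb w).
Proof. exact: (leftop_comp (leftop_sc _) (leftop_Tw_inv _)). Qed.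

Lemma scA r r' h : sc r (sc r' h) = sc (r * r') h.
Proof. by coord; ring. Qed.

Lemma Tb1 h : Tb 1%g h = h.
Proof.
rewrite /Tb /Tw_inv invg1; case: rwP => [_|a b ab]; last by rewrite invg1 !perm1 ab ltnNge leqnSn.
have -> : len (1%g : perm_n) = 0%N.
  by apply/eqP; rewrite cards_eq0; apply/eqP/setP => -[p q]; rewrite !inE !perm1 /=; lia.
by coord; ring.
Qed.

Lemma mulH_tTinvU (C : {set 'I_n}) h : mulH t (tTinvU t C) h = Tb (uC C) h.
Proof. exact: (mulH_leftop _ (leftop_Tb (uC C))). Qed.

Lemma mulH_bT w h : mulH t (bT R w) h = Tw_act t w h.
Proof. by rewrite -Tw_act_bT1; apply: mulH_leftop (leftop_Tw w). Qed.

Lemma mulH_bT_sP a b h : b = a.+1 :> nat -> mulH t (bT R (sP n a)) h = T_ a h.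
Proof.
move=> ab; rewrite -(mulH_leftop h (leftop_Ti ab)) (Ti_bT ab) ?invg1 ?perm1 ?ab //.
by rewrite /pc mul1g.
Qed.

Hypothesis ht : t \is a GRing.unit.

Lemma TiK a b : b = a.+1 :> nat -> cancel (T_ a) (@Tinv_act n R t a).
Proof.
move=> ab h; rewrite /Tinv_act (Ti_sqr _ ab); apply/ffunP => w; rewrite !ffunE.
transitivity (t^-1 * t * h w); first by ring.
by rewrite mulVr ?mul1r.
Qed.

Lemma TinvK a b : b = a.+1 :> nat -> cancel (@Tinv_act n R t a) (T_ a).
Proof.
move=> ab h; rewrite /Tinv_act (linZ _ _ (@lin_Ti a)) (linD _ _ (@lin_Ti a)).
rewrite (linZ _ _ (@lin_Ti a)) (Ti_sqr _ ab); apply/ffunP => w; rewrite !ffunE.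
transitivity (t^-1 * t * h w); first by ring.
by rewrite mulVr ?mul1r.
Qed.

Lemma Tw_actK w : cancel (Tw_act t w) (Tw_inv w).
Proof.
move=> h; move k: (len w) => m; elim: m w k => [|m IH] w; rewrite /Tw_inv /Tw_act;
  case: rwP => [_ _|a b ab _ ->] //=.
by move=> [/IH E]; rewrite (TiK ab) -[RHS]E.
Qed.

Lemma Tw_invK w : cancel (Tw_inv w) (Tw_act t w).
Proof.
move=> h; move k: (len w) => m; elim: m w h k => [|m IH] w h; rewrite /Tw_inv /Tw_act;
  case: rwP => [_ _|a b ab _ ->] //=.
by move=> [/IH E]; rewrite [foldr _ _ _]E (TinvK ab).
Qed.

Lemma TbarE i h : Tbar i h = sc t (Tinv_act t i h).
Proof.
apply/ffunP => w; rewrite !ffunE mulrA divrr ?mul1r //.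
Qed.

(** The length grows by one, and the extra factor [t] turns the inverse of [T_a] into [Tbar a]. The
    remaining identity between inverses is tested after applying the injective [Tw_act] of
    [w^-1 s_a]. *)
Lemma Tb_asc a b w h : b = a.+1 :> nat -> (w^-1%g a < w^-1%g b)%N ->
  Tb (pc (sP n a) w) h = Tbar a (Tb w h).
Proof.
move=> ab asc; rewrite TbarE /Tb (len_asc ab asc) (linZ _ _ (proj1 (leftop_Tinv ab))) scA -exprS.
congr sc; have -> : ((pc (sP n a) w)^-1 = pc w^-1 (sP n a))%g.
  by rewrite /pc invMg (sPE ab) tpermV.
apply: (can_inj (@Tw_actK (pc w^-1%g (sP n a)))).
by rewrite Tw_invK (Tw_act_rasc _ ab) // (TinvK ab) Tw_invK.
Qed.

Lemma Tb_rasc a b w h : b = a.+1 :> nat -> (w a < w b)%N ->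
  Tb (pc w (sP n a)) h = Tb w (Tbar a h).
Proof.
move=> ab asc; rewrite TbarE /Tb -len_inv (linZ _ _ (proj1 (leftop_Tw_inv _))) scA -exprSr.
have -> : ((pc w (sP n a))^-1 = pc (sP n a) w^-1)%g.
  by rewrite /pc invMg (sPE ab) tpermV.
rewrite (len_asc ab) ?invgK // len_inv.
congr sc; apply: (can_inj (@Tw_actK (pc (sP n a) w^-1%g))).
by rewrite Tw_invK (Tw_act_asc _ ab) ?invgK // Tw_invK (TinvK ab).
Qed.

Lemma mulH_TwInv_sP a b h : b = a.+1 :> nat -> mulH t (sc t (TwInv t (sP n a))) h = Tbar a h.
Proof.
move=> ab; rewrite -(mulH_leftop h (leftop_Tbar ab)) TbarE.
congr (mulH t (sc t _) h); rewrite /TwInv -/(Tw_inv _ _).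
apply: (can_inj (@Tw_actK (sP n a))); rewrite Tw_invK.
have -> : sP n a = pc (sP n a) 1%g by rewrite /pc mul1g.
by rewrite (Tw_act_asc _ ab) ?invg1 ?perm1 ?ab // Tw_act1 (TinvK ab).
Qed.

End HeckeOperators.

(** * Minimal coset representatives, components of an element, and the operators [Kop] *)

Section Columns.
Variables (n : nat) (R : comUnitRingType) (t : R).
Local Notation perm_n := {perm 'I_n}.
Local Notation Hn := {ffun perm_n -> R}.
Local Notation T_ := (@Ti_act n R t).
Implicit Types (a b c d x y : 'I_n) (u v w : perm_n) (h g : Hn) (f : Hn -> Hn)
  (C D E F : {set 'I_n}) (l : nat).

Lemma sorted_enum C : sorted ltn [seq val x | x <- enum C].
Proof.
rewrite sorted_map /enum_mem; apply: sorted_filter; first by move=> x y z; apply: ltn_trans.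
by rewrite -enumT -sorted_map val_enum_ord iota_ltn_sorted.
Qed.

(* [u] is the shortest element of its coset modulo the stabilizer of [varpi l]. *)
Definition mincoset l u := forall x y, (x < y)%N -> (x < l)%N = (y < l)%N -> (u x < u y)%N.

Lemma uCE C x : uC C x = nth x (colL C) x.
Proof. by rewrite permE. Qed.

Lemma size_setC C : (#|C| + #|~: C|)%N = n.
Proof. by rewrite cardsC card_ord. Qed.

Lemma mem_uC C x : (uC C x \in C) = (x < #|C|)%N.
Proof.
rewrite uCE /colL nth_cat -cardE; case: ltnP => h.
  by rewrite -mem_enum mem_nth // -cardE.
apply/negbTE; rewrite -in_setC -mem_enum mem_nth // -cardE.
by rewrite ltn_subLR // size_setC.
Qed.

Lemma nth_enum_lt C x0 x1 i j : (i < j)%N -> (j < #|C|)%N ->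
  (nth x0 (enum C) i < nth x1 (enum C) j)%N.
Proof.
move=> ij jC; have sz : size (enum C) = #|C| by rewrite -cardE.
rewrite (set_nth_default x0 x1) ?sz //.
have tr : transitive (relpre (val : 'I_n -> nat) ltn) by move=> p q r; apply: ltn_trans.
have := sorted_enum C; rewrite sorted_map => sE.
by apply: (sorted_ltn_nth tr x0 sE) => //; rewrite inE sz // (ltn_trans ij).
Qed.

Lemma mincoset_uC C : mincoset #|C| (uC C).
Proof.
move=> x y xy; rewrite !uCE /colL !nth_cat -!cardE.
case: ltnP => hx; case: ltnP => hy // _; first exact: nth_enum_lt.
apply: nth_enum_lt; first by rewrite ltn_sub2r // (leq_ltn_trans hx).
by rewrite ltn_subLR // size_setC.
Qed.

(** The permutation sending [x] to [(uC C)^-1 (u x)] preserves the first [#|C|] positions as a set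
    and is increasing on them and on the remaining ones; hence it is increasing, so it is the
    identity. *)
Lemma mincoset_uniq C u : mincoset #|C| u -> (forall x, (u x \in C) = (x < #|C|)%N) -> u = uC C.
Proof.
move=> mu memu; set z := (u * (uC C)^-1)%g.
suff z1 : z = 1%g by rewrite -[u](mulgKV (uC C)) -/z z1 mul1g.
have uz x : uC C (z x) = u x by rewrite permM permKV.
have zl x : (z x < #|C|)%N = (x < #|C|)%N by rewrite -mem_uC uz memu.
apply: incr_perm1 => x y xy.
case: (boolP ((x < #|C|)%N == (y < #|C|)%N)) => [/eqP E|].
  rewrite ltnNge; apply/negP; rewrite leq_eqVlt => /orP[/eqP/ord_inj/perm_inj Exy|zz].
    by move: xy; rewrite Exy ltnn.
  have := mincoset_uC zz (etrans (zl y) (esym (etrans (zl x) E))).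
  by rewrite !uz; have := mu _ _ xy E; lia.
by move: (zl x) (zl y); move: #|_| => l; lia.
Qed.

(** Swapping the values [a] and [b] could only spoil the order inside a block if both positions were
    in the same block. *)
Lemma mincoset_sP l a b u : b = a.+1 :> nat ->
  (u^-1%g a < l)%N != (u^-1%g b < l)%N -> mincoset l u -> mincoset l (pc (sP n a) u).
Proof.
move=> ab N mu x y xy E; rewrite (sPE ab) /pc !permM tperm_adj_lt //; first exact: mu.
  by case=> ua ub; move: N; rewrite -ua -ub !permK E eqxx.
by case=> ua ub; move: N; rewrite -ua -ub !permK E eqxx.
Qed.

Lemma mem_sP_sC a x C : (sP n a x \in sC a C) = (x \in C).
Proof. by rewrite mem_imset //; apply: perm_inj. Qed.

Lemma card_sC a C : #|sC a C| = #|C|.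
Proof. by rewrite card_imset //; apply: perm_inj. Qed.

Lemma mem_inv_uC C x : ((uC C)^-1%g x < #|C|)%N = (x \in C).
Proof. by rewrite -mem_uC permKV. Qed.

Lemma uC_sC a b C : b = a.+1 :> nat -> (a \in C) != (b \in C) ->
  uC (sC a C) = pc (sP n a) (uC C).
Proof.
move=> ab N; symmetry; apply: mincoset_uniq; rewrite card_sC.
  by apply: (mincoset_sP ab) (@mincoset_uC C); rewrite !mem_inv_uC.
by move=> x; rewrite /pc permM mem_sP_sC mem_uC.
Qed.

Lemma sC_id a b C : b = a.+1 :> nat -> (a \in C) = (b \in C) -> sC a C = C.
Proof.
move=> ab E; apply/setP => x; rewrite -[x in LHS](permKV (sP n a)) mem_sP_sC (sPE ab) tpermV.
by case: tpermP => [->|->|].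
Qed.

(** The positions of [a] and [b] lie in one block, where [uC C] is increasing. A position strictly
    between them would carry a value strictly between [a] and [a + 1], so they are adjacent. *)
Lemma uC_conj a b C : b = a.+1 :> nat -> (a \in C) = (b \in C) ->
  exists c d, [/\ d = c.+1 :> nat, pc (sP n a) (uC C) = pc (uC C) (sP n c),
    stab (varpi #|C|) (sP n c), uC C c = a & uC C d = b].
Proof.
move=> ab E; pose c := (uC C)^-1%g a; pose d := (uC C)^-1%g b.
have uc : uC C c = a by rewrite permKV.
have ud : uC C d = b by rewrite permKV.
have cl : (c < #|C|)%N = (d < #|C|)%N by rewrite !mem_inv_uC.
have lt : (c < d)%N.
  rewrite ltnNge; apply/negP; rewrite leq_eqVlt => /orP[/eqP/ord_inj dc|dc].
    by move: ab; rewrite -uc -ud dc; lia.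
  by have := mincoset_uC dc (esym cl); rewrite uc ud; lia.
have cd : d = c.+1 :> nat.
  apply/eqP; rewrite eqn_leq lt andbT leqNgt; apply/negP => lt2.
  have hx : (c.+1 < n)%N by have := ltn_ord d; lia.
  have := @mincoset_uC C c (Ordinal hx) (ltnSn _); have := @mincoset_uC C (Ordinal hx) d lt2.
  have mid k : (c < k)%N = (d < k)%N -> (c < k)%N = (c.+1 < k)%N /\ (c.+1 < k)%N = (d < k)%N.
    by lia.
  have [E1 E2] := mid _ cl.
  by move=> /(_ E2) + /(_ E1); rewrite uc ud; lia.
exists c, d; split=> //.
  by rewrite (sPE ab) (sPE cd) /pc -uc -ud -tpermJ /conjg !mulgA mulgV mul1g.
rewrite (sPE cd); apply/forallP => x; rewrite /varpi.
by case: tpermP => [->|->|//]; rewrite cl.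
Qed.

Lemma stab_varpiP l v : reflect (forall x, (v x < l)%N = (x < l)%N) (stab (varpi l) v).
Proof.
apply: (iffP forallP) => [H x|H x]; last by rewrite /varpi H.
by have /eqP := H x; rewrite /varpi; do 2 case: (_ < _)%N.
Qed.

(** Lengths add. At a left descent of [u], the value [b] sits in the first block and [a] in the
    second; after removing it they trade blocks, and [v] preserves blocks, so the step back is an
    ascent for the product too. *)
Lemma Tw_act_mincoset l u v : mincoset l u -> stab (varpi l) v ->
  Tw_act t u (bT R v) = bT R (pc u v).
Proof.
move=> mu /stab_varpiP sv; move k: (len u) => m; elim: m u mu k => [|m IH] u mu;
  rewrite /Tw_act; case: rwP => [->|a b ab desc ->] //; rewrite ?/pc ?mulg1 //.
have N : (u^-1%g a < l)%N != (u^-1%g b < l)%N.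
  apply/negP => /eqP/esym E; have := mu _ _ desc E; rewrite !permKV; lia.
move=> [/(IH _ (mincoset_sP ab N mu)) E] /=.
rewrite [foldr _ _ _]E (Ti_bT _ ab) /pc; first by rewrite -!mulgA (sPE ab) tperm2 mulg1.
have [Ea Eb] := inv_pc_sP u ab; rewrite invMg !permM Ea Eb.
have svV x : (v^-1%g x < l)%N = (x < l)%N by rewrite -[in RHS](permKV v x) sv.
have := svV (u^-1%g a); have := svV (u^-1%g b); move: N desc.
case: (ltnP (u^-1%g a) l); case: (ltnP (u^-1%g b) l) => //= lb la _ desc; first by lia.
by move=> lt ge; rewrite (leq_trans lt) // leqNgt ge.
Qed.

Lemma Tw_act_par l u g : mincoset l u -> inHpar (varpi l) g ->
  Tw_act t u g = [ffun w => g (pc u^-1%g w)].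
Proof.
move=> mu gp; apply/ffunP => w; rewrite [g in LHS]basis_expand.
rewrite (lin_sum _ _ _ (proj1 (leftop_Tw _ _))) sum_ffunE ffunE.
rewrite (bigD1 (pc u^-1%g w)) //= big1 => [|v vN];
  rewrite (linZ _ _ (proj1 (leftop_Tw _ _))) ffunE.
  have [->|/gp sv] := eqVneq (g (pc u^-1%g w)) 0; first by rewrite mul0r addr0.
  by rewrite (Tw_act_mincoset mu sv) ffunE /pc mulgKV eqxx mulr1 addr0.
have [->|/gp sv] := eqVneq (g v) 0; first by rewrite mul0r.
rewrite (Tw_act_mincoset mu sv) ffunE; case: eqP => [E|_]; last by rewrite mulr0.
by move: vN; rewrite E /pc mulgK eqxx.
Qed.

Definition comp l h F : Hn := [ffun v => if stab (varpi l) v then h (pc (uC F) v) else 0].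

Lemma card_hw_col l : (l <= n)%N -> #|hw_col n l| = l.
Proof.
move=> ln; have -> : hw_col n l = widen_ord ln @: [set: 'I_l].
  apply/setP => x; rewrite inE; apply/idP/imsetP => [xl|[y _ ->]]; last exact: (ltn_ord y).
  by exists (Ordinal xl) => //; apply: val_inj.
by rewrite card_imset ?cardsT ?card_ord // => x y /(congr1 val) /= /val_inj.
Qed.

Lemma stab_uC F w :
  stab (varpi #|F|) (pc (uC F)^-1%g w) = (F == w @: hw_col n #|F|).
Proof.
apply/stab_varpiP/eqP => [H|E x].
  apply/setP => y; rewrite -[y](permKV w) mem_imset ?inE; last exact: perm_inj.
  by rewrite -H /pc permM mem_inv_uC.
by rewrite /pc permM mem_inv_uC {1}E mem_imset ?inE //; apply: perm_inj.
Qed.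

Lemma inHpar_comp l h F : inHpar (varpi l) (comp l h F).
Proof. by move=> w; rewrite ffunE; case: ifP; rewrite // eqxx. Qed.

(** [hcomp] is an epsilon choice, so [comp] is first shown to be a decomposition: each [w] lies in
    exactly one coset, that of the column [w @: hw_col n l]. The coefficients of [h] on the coset of
    [uC C] then force the chosen component at [C]. *)
Lemma hcompE h C : hcomp t #|C| h C = comp #|C| h C.
Proof.
set l := #|C|.
have mulE (f : {set 'I_n} -> Hn) F : (forall F, inHpar (varpi l) (f F)) -> #|F| = l ->
    mulH t (bT R (uC F)) (f F) = [ffun w => f F (pc (uC F)^-1%g w)].
  move=> fp Fl; rewrite mulH_bT; apply: (Tw_act_par (l := l)) => //.
  by rewrite -Fl; apply: mincoset_uC.
have ex : decomp t l h (comp l h).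
  split=> [F|]; first exact: inHpar_comp.
  apply/ffunP => w; have Fl : #|w @: hw_col n l| = l.
    rewrite card_imset ?card_hw_col //; last exact: perm_inj.
    by rewrite -[X in (_ <= X)%N](size_setC C) leq_addr.
  rewrite sum_ffunE (bigD1 (w @: hw_col n l)) ?Fl ?eqxx //=.
  rewrite mulE //; last exact: inHpar_comp.
  rewrite !ffunE -{1}Fl stab_uC Fl eqxx /pc mulgKV big1 ?addr0 // => F /andP[/eqP FE FN].
  rewrite mulE //; last exact: inHpar_comp.
  by rewrite !ffunE -{1}FE stab_uC FE (negbTE FN).
have [fp hE] := epsilon_spec (inhabits (fun _ => 0)) _ (ex_intro _ _ ex).
rewrite -/(hcomp t l h) in fp hE *; move: (hcomp t l h) fp hE => f fp hE.
apply/ffunP => v; rewrite ffunE; case: ifP => [sv|/negP sv]; last first.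
  by apply/eqP; rewrite -[_ == _]negbK; apply/negP => /fp.
rewrite hE sum_ffunE (bigD1 C) //= mulE // ffunE /pc mulgK big1 ?addr0 // => F /andP[/eqP FE FN].
rewrite mulE // ffunE; apply/eqP; rewrite -[_ == _]negbK; apply/negP => /fp.
rewrite -{1}FE stab_uC FE => /eqP EF; case/eqP: FN; rewrite EF.
by apply/esym/eqP; rewrite -stab_uC /pc mulgK.
Qed.

Lemma lin_comp_par l C : lin (fun h => comp l h C).
Proof. by move=> r h g; coord; case: ifP => _; rewrite ?ffunE; ring. Qed.

Lemma stabM l u v : stab (varpi l) u -> stab (varpi l) (pc u v) = stab (varpi l) v.
Proof.
move=> /stab_varpiP su; apply/stab_varpiP/stab_varpiP => H x; have := H x;
  by rewrite /pc permM su.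
Qed.

Lemma pcA u v w : pc u (pc v w) = pc (pc u v) w.
Proof. by rewrite /pc mulgA. Qed.

Lemma inv_pc u v x : ((pc u v)^-1 x = v^-1 (u^-1 x))%g.
Proof. by rewrite /pc invMg permM. Qed.

Lemma stab_inv l v x : stab (varpi l) v -> (v^-1%g x < l)%N = (x < l)%N.
Proof. by move=> /stab_varpiP H; rewrite -[in RHS](permKV v x) H. Qed.

(** In every element of the coset of [uC C], the value [a] lies in the first block and [b] in the
    second, so one branch of [Ti_actE] governs the whole coset. In [comp_Ti_pos] the blocks are
    exchanged and the other branch applies. *)
Lemma comp_Ti_neg a b C h : b = a.+1 :> nat -> a \in C -> b \notin C ->
  comp #|C| (T_ a h) C = sc t (comp #|C| h (sC a C)).
Proof.
move=> ab aC bC; apply/ffunP => v; rewrite !ffunE; case: ifP => sv; last by rewrite mulr0.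
rewrite (Ti_actE _ _ _ ab) pcA (uC_sC ab) ?aC ?(negbTE bC) // !inv_pc.
have := stab_inv ((uC C)^-1%g a) sv; have := stab_inv ((uC C)^-1%g b) sv.
rewrite !mem_inv_uC aC (negbTE bC) => lb la.
by have -> : (v^-1%g ((uC C)^-1%g a) < v^-1%g ((uC C)^-1%g b))%N by lia.
Qed.

Lemma comp_Ti_pos a b C h : b = a.+1 :> nat -> a \notin C -> b \in C ->
  comp #|C| (T_ a h) C = comp #|C| h (sC a C) + sc (t - 1) (comp #|C| h C).
Proof.
move=> ab aC bC; apply/ffunP => v; rewrite !ffunE; case: ifP => sv; last by rewrite mulr0 addr0.
rewrite (Ti_actE _ _ _ ab) pcA (uC_sC ab) ?bC ?(negbTE aC) // !inv_pc.
have := stab_inv ((uC C)^-1%g a) sv; have := stab_inv ((uC C)^-1%g b) sv.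
rewrite !mem_inv_uC bC (negbTE aC) => lb la.
by have -> : (v^-1%g ((uC C)^-1%g a) < v^-1%g ((uC C)^-1%g b))%N = false by lia.
Qed.

Lemma comp_Ti_eq a b c d C h : b = a.+1 :> nat -> d = c.+1 :> nat ->
  pc (sP n a) (uC C) = pc (uC C) (sP n c) -> stab (varpi #|C|) (sP n c) ->
  uC C c = a -> uC C d = b -> comp #|C| (T_ a h) C = T_ c (comp #|C| h C).
Proof.
move=> ab cd cE sc_ uc ud; apply/ffunP => v; rewrite (Ti_actE _ _ _ cd) !ffunE stabM //.
case: ifP => sv; last by rewrite !mulr0 addr0; case: ifP.
by rewrite (Ti_actE _ _ _ ab) !pcA -cE -uc -ud !inv_pc !permK.
Qed.

(* The operator [Psi_S |-> Psi_(C (x) S)]. *)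
Definition Kop C h := Tb t (uC C) (comp #|C| h C).

Lemma lin_Kop C : lin (Kop C).
Proof. exact: (lin_comp (proj1 (leftop_Tb t (uC C))) (@lin_comp_par _ _)). Qed.

(** As for [sigb], [true] encodes the sign -1; the two values are the two operators appearing in
    (c). *)
Definition Tsgn (s : bool) (i : nat) h := if s then T_ i h else Tbar t i h.

Hypothesis ht : t \is a GRing.unit.

(** Here [s] is the sign of the right neighbour and [sC'] that of [C]. It suffices to treat [T_a],
    which differs from [Tbar a] by the scalar [t - 1]; equal signs make the scalars cancel, and
    opposite signs leave one term of [Sigma]. *)
Lemma Kop_Tsgn a b C (s : bool) h : b = a.+1 :> nat ->
  let sC' := (a \in C) && (b \notin C) in
  Kop C (Tsgn s a h) = Tsgn sC' a (Kop (sC a C) h) +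
    (if s != sC' then sc ((-1) ^+ s * (1 - t)) (Kop C h) else 0).
Proof.
move=> ab sC'.
have KTbar k : Kop C (Tbar t a k) = Kop C (T_ a k) + sc (1 - t) (Kop C k).
  by rewrite (linD _ _ (lin_Kop C)) (linZ _ _ (lin_Kop C)).
have TbE w := linZ _ _ (proj1 (leftop_Tb t w)).
have TbD w := linD _ _ (proj1 (leftop_Tb t w)).
have Keq : (a \in C) = (b \in C) ->
    Kop C (T_ a h) = Tbar t a (Kop (sC a C) h) + sc (t - 1) (Kop C h).
  move=> E; have [c [d [cd cE stc uc ud]]] := uC_conj ab E.
  have -> : Kop C (T_ a h) = T_ a (Kop C h).
    rewrite /Kop (comp_Ti_eq _ ab cd cE stc uc ud); move: (comp _ h C) => k.
    (* Adding the scalar term turns [T_a] and [T_c] into [Tbar a] and [Tbar c], and both [Tb_asc]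
       and [Tb_rasc] apply to [s_a uC = uC s_c]. *)
    apply: (addIr (sc (1 - t) (Tb t (uC C) k))).
    rewrite -[RHS]/(Tbar t a _) -(Tb_asc ht _ ab) -?uc -?ud ?permK ?cd //.
    by rewrite uc cE (Tb_rasc ht _ cd) ?uc ?ud ?ab // TbD TbE.
  by rewrite (sC_id ab E) /Tbar; coord; ring.
have KT : Kop C (T_ a h) = if sC' then T_ a (Kop (sC a C) h) else
   Tbar t a (Kop (sC a C) h) + sc (t - 1) (Kop C h).
  rewrite /sC'; case: (boolP (a \in C)) => aC; case: (boolP (b \in C)) => bC /=.
  - exact: Keq (etrans aC (esym bC)).
  - have asc : ((uC C)^-1%g a < (uC C)^-1%g b)%N.
      by have := mem_inv_uC C a; have := mem_inv_uC C b; rewrite aC (negbTE bC); lia.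
    rewrite /Kop (comp_Ti_neg _ ab) // card_sC TbE (uC_sC ab) ?aC ?(negbTE bC) //.
    (* The factor [t] produced by [comp_Ti_neg] is accounted for by [T_a (Tbar a k) = t k]. *)
    by rewrite (Tb_asc ht _ ab asc) TbarE // (linZ _ _ (@lin_Ti _ _ _ a)) (TinvK ht ab).
  - have N : (a \in C) != (b \in C) by rewrite bC (negbTE aC).
    have asc : ((uC (sC a C))^-1%g a < (uC (sC a C))^-1%g b)%N.
      rewrite (uC_sC ab N); have [-> ->] := inv_pc_sP (uC C) ab.
      by have := mem_inv_uC C a; have := mem_inv_uC C b; rewrite bC (negbTE aC); lia.
    rewrite /Kop (comp_Ti_pos _ ab) // card_sC TbD TbE -(Tb_asc ht _ ab asc).
    by rewrite (uC_sC ab N) pc_sPK.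
  - exact: Keq (etrans (negbTE aC) (esym (negbTE bC))).
by case: s; rewrite /Tsgn ?KTbar KT; case: (sC') => /=; rewrite /Tbar; coord; ring.
Qed.

End Columns.

(** * Vanishing, highest weight values and the recursion for tableaux *)

Section Tableaux.
Variables (n : nat) (R : comUnitRingType) (t : R).
Local Notation perm_n := {perm 'I_n}.
Local Notation Hn := {ffun perm_n -> R}.
Local Notation T_ := (@Ti_act n R t).
Implicit Types (a b c d x y : 'I_n) (u v w : perm_n) (h g : Hn)
  (C D E F : {set 'I_n}) (l k : nat) (T U : seq {set 'I_n}).

(* Unlike [Psi], this is [1_0] at the empty tableau, which makes the recursion uniform. *)
Definition PsiR T : Hn := foldr (Kop t) (one_ R (fun=> 0%N)) T.

Lemma one_E (lam : 'I_n -> nat) w : one_ R lam w = (stab lam w)%:R.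
Proof.
rewrite /one_ sum_ffunE; case: (boolP (stab lam w)) => sw.
  rewrite (bigD1 w) //= ffunE eqxx big1 ?addr0 // => v /andP[_ vw].
  by rewrite ffunE eq_sym (negbTE vw).
by rewrite big1 // => v sv; rewrite ffunE; case: eqP => // E; move: sw; rewrite E sv.
Qed.

Lemma PsiE T : T != [::] -> Psi t T = PsiR T.
Proof.
elim: T => [|C [|D S] IH] // _ /=.
  rewrite /Psi_col mulH_tTinvU; congr Tb.
  (* All permutations stabilize the zero weight, so the component of [1_0] at [C] is the sum over
     the stabilizer of [varpi #|C|]. *)
  apply/ffunP => w; rewrite ffunE !one_E; case: ifP => //.
  by move=> _; rewrite [stab _ (pc _ _)](introT forallP).
by rewrite mulH_tTinvU hcompE // -[RHS]/(Kop t C (PsiR (D :: S))) -IH.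
Qed.

(** Larger counts mean smaller entries. Unlike entries, these counts are easy to follow under [sC]
    and under inclusion of columns. *)
Definition cnt E k := #|[set y in E | (y < k)%N]|.

Lemma cnt_count E k : cnt E k = count (fun i => i < k)%N [seq val x | x <- enum E].
Proof.
rewrite count_map -sum1_count big_enum_cond /cnt -sum1_card.
by apply: eq_bigl => x; rewrite inE.
Qed.

Lemma nth_sorted_lt (s : seq nat) k m : sorted ltn s -> (k < size s)%N ->
  (nth 0%N s k < m)%N = (k < count (fun i => i < m)%N s)%N.
Proof.
elim: s k => [|p s IH] k //=; rewrite (path_sortedE ltn_trans) => /andP[/allP ps ss].
case: (ltnP p m) => pm; first by case: k => [|k] //= ks; rewrite add1n ltnS IH.
have -> : count (fun i => i < m)%N s = 0%N.
  by apply/eqP; rewrite -leqn0 leqNgt -has_count; apply/hasPn => q /ps; lia.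
case: k => [|k] //= ks; first by rewrite ltnNge pm.
by apply/negbTE; rewrite -leqNgt (leq_trans pm) // ltnW // ps // mem_nth.
Qed.

Lemma entry_lt E k m : (k < #|E|)%N -> (entry E k < m)%N = (k < cnt E m)%N.
Proof.
by move=> kE; rewrite cnt_count -nth_sorted_lt ?sorted_enum // size_map -cardE.
Qed.

Lemma cnt_le_card E k : (cnt E k <= #|E|)%N.
Proof. by apply/subset_leq_card/subsetP => x; rewrite inE => /andP[]. Qed.

Lemma cnt_entry_le C D : (forall k, cnt D k <= cnt C k)%N ->
  [forall k : 'I_n, (k < #|D|)%N ==> (entry C k <= entry D k)%N].
Proof.
move=> le; apply/forallP => k; apply/implyP => kD.
have kC : (k < cnt C (entry D k).+1)%N by apply: leq_trans (le _); rewrite -entry_lt.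
by rewrite -ltnS entry_lt // (leq_trans kC) // cnt_le_card.
Qed.

Lemma cnt_subset C D k : C \subset D -> (cnt C k <= cnt D k)%N.
Proof.
move=> /subsetP CD; apply/subset_leq_card/subsetP => x.
by rewrite !inE => /andP[/CD -> ->].
Qed.

Lemma cnt_mono E k m : (k <= m)%N -> (cnt E k <= cnt E m)%N.
Proof.
move=> km; apply/subset_leq_card/subsetP => x; rewrite !inE => /andP[-> /=].
by move=> xk; apply: leq_trans km.
Qed.

Lemma cnt_sC a b E k : b = a.+1 :> nat -> k <> b -> cnt (sC a E) k = cnt E k.
Proof.
move=> ab kb; rewrite /cnt -[RHS](card_imset _ (@perm_inj _ (sP n a))); apply: eq_card => x.
rewrite -[x](permKV (sP n a)) mem_imset; last exact: perm_inj.
by rewrite !inE mem_sP_sC (sPE ab) (tperm_adj_ltn_bound _ ab kb).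
Qed.

Lemma cnt_notin a b E : b = a.+1 :> nat -> a \notin E -> cnt E b = cnt E a.
Proof.
move=> ab aE; apply: eq_card => x; rewrite !inE ab ltnS leq_eqVlt.
by case: (x =P a :> nat) => [/ord_inj ->|//]; rewrite (negbTE aE).
Qed.

(** Only the threshold [b] is affected. There the count of [sC a D] equals that of [D] at [a], where
    [sC a] does not change the counts of [E]. *)
Lemma cnt_sC_le a b D E : b = a.+1 :> nat -> a \in D -> b \notin D ->
  (forall k, cnt D k <= cnt E k)%N ->
  forall k, (cnt (sC a D) k <= cnt E k)%N /\ (cnt (sC a D) k <= cnt (sC a E) k)%N.
Proof.
move=> ab aD bD le k; have ba : (a : nat) <> b by lia.
have [->|/eqP kb] := eqVneq k b; last by rewrite !(cnt_sC _ ab kb).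
have aN : a \notin sC a D.
  by have := mem_sP_sC a b D; rewrite (sPE ab) tpermR => ->.
rewrite (cnt_notin ab aN) (cnt_sC _ ab ba).
split; first by apply: leq_trans (le _) (cnt_mono _ _); rewrite ab.
by apply: leq_trans (le _) _; rewrite -(cnt_sC _ ab ba) cnt_mono // ab.
Qed.

Lemma sC_imset a u E : sC a (u @: E) = pc (sP n a) u @: E.
Proof.
rewrite /sC -imset_comp; apply: eq_imset => x.
by rewrite /pc permM.
Qed.

Lemma stab_hw_col l v : stab (varpi l) v -> v @: hw_col n l = hw_col n l.
Proof.
move=> /stab_varpiP sv; apply/setP => x.
by rewrite -[x](permKV v) mem_imset ?inE ?sv //; apply: perm_inj.
Qed.

Lemma uC_hw C : uC C @: hw_col n #|C| = C.
Proof.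
apply/setP => x; rewrite -[x](permKV (uC C)) mem_imset ?inE ?mem_uC //; exact: perm_inj.
Qed.

Lemma uC_hw_col C : is_hw_col C -> uC C = 1%g.
Proof.
move=> /eqP hw; symmetry; apply: mincoset_uniq => [x y xy _|x]; first by rewrite !perm1.
by rewrite perm1 {1}hw inE.
Qed.

Lemma PsiR_highest_weight T : highest_weight T -> PsiR T = one_ R (tshape T).
Proof.
elim: T => [|C T IH] //= /andP[hwC /IH E].
rewrite [X in Kop t C X]E /Kop (uC_hw_col hwC) Tb1.
apply/ffunP => v; rewrite ffunE !one_E /pc uC_hw_col // mulg1.
have dom S x y : (x <= y)%N -> (tshape S y <= tshape S x)%N.
  by move=> xy; apply: sub_count => D /= yD; apply: leq_ltn_trans yD.
have -> : stab (tshape (C :: T)) v = stab (varpi #|C|) v && stab (tshape T) v.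
  rewrite /stab; apply/forallP/andP => [H|[/forallP H1 /forallP H2] x].
    (* Both weights are weakly decreasing, so between [x] and [v x] they vary in the same direction
       and equality of the sums splits. *)
    have H' x : varpi #|C| (v x) = varpi #|C| x /\ tshape T (v x) = tshape T x.
      have /eqP := H x; rewrite -[tshape (C :: T)]/(fun y => varpi #|C| y + tshape T y)%N /=.
      have domC y (z : 'I_n) : (y <= z)%N -> (varpi #|C| z <= varpi #|C| y)%N.
        by rewrite /varpi => yz; case: (ltnP z) => // /(leq_ltn_trans yz) ->.
      have split_eq (p q r s : nat) : (p <= r -> q <= s -> p + q = r + s -> p = r /\ q = s)%N.
        by lia.
      case: (leqP x (v x)) => [le|/ltnW le Es]; first exact: split_eq (domC _ _ le) (dom T _ _ le).
      by have [-> ->] := split_eq _ _ _ _ (domC _ _ le) (dom T _ _ le) (esym Es).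
    by split; apply/forallP => x; have [E1 E2] := H' x; rewrite ?E1 ?E2.
  have := H1 x; have := H2 x; rewrite /tshape /varpi /=.
  by move=> /eqP-> /eqP->.
by case: (stab (varpi _) v).
Qed.

Lemma inCE C x : inC C x = (x \in C).
Proof.
apply/existsP/idP => [[y /andP[yC /eqP/val_inj <-]]|xC] //.
by exists x; rewrite xC /=.
Qed.

Lemma colk_cons C T k : (0 < k <= size T)%N -> colk (C :: T) k = colk T k.
Proof. by move=> /andP[k0 kT]; rewrite /colk /= subSn. Qed.

Lemma Omega_cons j C T k : (k <= size T)%N -> Omega j k (C :: T) = C :: Omega j k T.
Proof. by move=> kT; rewrite /Omega /= subSn. Qed.

Lemma Omega_size j T : Omega j (size T) T = map (sC j) T.
Proof. by rewrite /Omega subnn take0 drop0. Qed.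

(** [PsiR U] is the indicator of the stabilizer of the shape, and composing with an [s_a] that fixes
    the shape preserves this stabilizer. This feeds the base case of [PsiR_rec]. *)
Lemma stab_hw_comp a b C U : b = a.+1 :> nat -> highest_weight U ->
  tshape U a = tshape U b -> (a \in C) != (b \in C) ->
  comp #|C| (PsiR U) (sC a C) = comp #|C| (PsiR U) C.
Proof.
move=> ab hwU Eab N; rewrite PsiR_highest_weight //.
apply/ffunP => v; rewrite !ffunE !one_E (uC_sC ab N) (sPE ab).
case: ifP => // _; congr (_%:R); congr (nat_of_bool _).
have E x : tshape U (tperm a b x) = tshape U x by case: tpermP => [->|->|].
by apply: eq_forallb => x; rewrite /pc !permM E.
Qed.

Lemma highest_weight_T0 (mu : 'I_n -> nat) : highest_weight (T0 mu).
Proof.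
apply/allP => C /mapP[c _ ->]; rewrite /is_hw_col card_hw_col //.
by rewrite -[X in (_ <= X)%N]card_ord max_card.
Qed.

(** The entry of [D] in row [x] is [x] itself, so [C] has at least [x + 1] elements among
    [0, ..., x] and contains them all. *)
Lemma semistandard_hw_mem C D U x : is_hw_col D -> (#|D| <= #|C|)%N ->
  semistandard [:: C, D & U] -> (x < #|D|)%N -> x \in C.
Proof.
move=> /eqP hwD DC /= /andP[/forallP le _] xD.
have xn : #|hw_col n x.+1| = x.+1 by apply: card_hw_col.
have entD : (entry D x <= x)%N.
  rewrite -ltnS entry_lt // /cnt -[X in (X <= _)%N]xn; apply/subset_leq_card/subsetP => y.
  rewrite !inE => yx; rewrite yx andbT hwD inE; exact: leq_trans yx xD.
have cC : (x < cnt C x.+1)%N.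
  by rewrite -entry_lt ?(leq_trans xD) // ltnS (leq_trans (implyP (le x) xD)).
suff /setP/(_ x) : [set y in C | (y < x.+1)%N] = hw_col n x.+1 by rewrite !inE ltnSn andbT.
apply/eqP; rewrite eqEcard xn cC andbT; apply/subsetP => y.
by rewrite !inE => /andP[].
Qed.

(** If the first and longest column of [T0 mu] had length greater than [a], then
    [semistandard_hw_mem] would put [a] in [C]. So no column reaches row [a] or row [b], and both
    parts of the shape vanish. *)
Lemma tshape_T0 (mu : 'I_n -> nat) a b C : b = a.+1 :> nat -> (plen mu <= #|C|)%N ->
  semistandard (C :: T0 mu) -> a \notin C -> tshape (T0 mu) a = tshape (T0 mu) b.
Proof.
move=> ab pl ss aC.
have small D : D \in T0 mu -> (#|D| <= a)%N.
  move=> DT; have [c c1 DE] : exists2 c, (1 <= c)%N & D = hw_col n (conj_part mu c).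
    by case/mapP: DT => c; rewrite mem_iota => /andP[c1 _] ->; exists c.
  have cn k : (conj_part mu k <= n)%N by rewrite -[X in (_ <= X)%N]card_ord max_card.
  rewrite DE card_hw_col //; have le1 : (conj_part mu c <= conj_part mu 1)%N.
    by apply/subset_leq_card/subsetP => x; rewrite !inE => cx; apply: leq_trans cx.
  apply: (leq_trans le1); rewrite leqNgt; apply/negP => lt.
  case E : (T0 mu) ss DT => [|D1 U] ss // _.
  have D1E : D1 = hw_col n (conj_part mu 1).
    by move: E; rewrite /T0; case: (\max_i mu i) => [|m] //= [<-].
  case/negP: aC; apply: (semistandard_hw_mem _ _ ss).
  - by rewrite /is_hw_col D1E card_hw_col.
  - rewrite D1E card_hw_col //; apply: leq_trans pl; apply/subset_leq_card/subsetP => x.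
    by rewrite !inE -lt0n.
  - by rewrite D1E card_hw_col.
rewrite /tshape; apply: eq_in_count => D /small le.
by rewrite [LHS]ltnNge [RHS]ltnNge le ab (leq_trans le).
Qed.

Hypothesis ht : t \is a GRing.unit.

(** By induction on the length of [u]: a factor [Tbar a] mixes only the coefficients at [w] and
    [s_a w], and the two halves of [cnt_sC_le] carry the bound through either one. *)
Lemma Tb_support l u h w : mincoset l u -> inHpar (varpi l) h -> Tb t u h w != 0 ->
  forall k, (cnt (u @: hw_col n l) k <= cnt (w @: hw_col n l) k)%N.
Proof.
move=> mu hp.
have base v : Tb t 1%g h v != 0 ->
    forall k, (cnt ((1%g : perm_n) @: hw_col n l) k <= cnt (v @: hw_col n l) k)%N.
  rewrite Tb1 // => /hp sv k; rewrite (stab_hw_col sv) (stab_hw_col (v := 1%g)) //.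
  by apply/stab_varpiP => x; rewrite perm1.
move k: (len u) => m; elim: m u mu w k => [|m IH] u mu w; case: (rwP u) => [-> _|a b ab desc ->].
1,3: exact: base.
  by [].
move=> [lm].
have N : (u^-1%g a < l)%N != (u^-1%g b < l)%N.
  apply/negP => /eqP/esym E; have := mu _ _ desc E; rewrite !permKV; lia.
have lb : (u^-1%g b < l)%N by move: N desc; do 2 case: ltnP => //; lia.
have la : (u^-1%g a < l)%N = false by move: N; rewrite lb; case: ltnP.
have := IH _ (mincoset_sP ab N mu) _ lm; set u' := pc (sP n a) u => {}IH.
have uE : u = pc (sP n a) u' by rewrite pc_sPK.
have memu' x : (x \in u' @: hw_col n l) = (u'^-1%g x < l)%N.
  by rewrite -[x in LHS](permKV u') mem_imset ?inE //; apply: perm_inj.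
have [Ea Eb] := inv_pc_sP u ab.
have aD : a \in u' @: hw_col n l by rewrite memu' Ea.
have bD : b \notin u' @: hw_col n l by rewrite memu' Eb la.
have asc : (u'^-1%g a < u'^-1%g b)%N by rewrite Ea Eb.
rewrite [u in Tb _ u _]uE (Tb_asc ht _ ab asc).
have -> g : Tbar t a g w = T_ a g w + (1 - t) * g w by rewrite !ffunE.
rewrite (Ti_actE _ _ _ ab) => nz.
have -> : u @: hw_col n l = sC a (u' @: hw_col n l) by rewrite sC_imset -uE.
move=> k.
have [g0|/IH le] := eqVneq (Tb t u' h w) 0; last by have [] := cnt_sC_le ab aD bD le k.
have [g1|/IH le] := eqVneq (Tb t u' h (pc (sP n a) w)) 0.
  by move: nz; rewrite g0 g1; case: ifP => _; rewrite !(mulr0, addr0) eqxx.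
have wE : sC a (pc (sP n a) w @: hw_col n l) = w @: hw_col n l by rewrite sC_imset pc_sPK.
by have [_] := cnt_sC_le ab aD bD le k; rewrite wE.
Qed.

(** [Kop t C] reads only the coset of [uC C], whose elements send the first [#|C|] positions into
    [C]; the image of the first [#|D|] is then a subset of [C], with smaller counts. *)
Lemma PsiR_cnt C D T : (#|D| <= #|C|)%N -> PsiR [:: C, D & T] <> 0 ->
  forall k, (cnt D k <= cnt C k)%N.
Proof.
move=> DC nz k; apply: NNPP => nle; apply: nz.
have -> : PsiR [:: C, D & T] = Kop t C (Kop t D (PsiR T)) by [].
have Z : comp #|C| (Kop t D (PsiR T)) C = 0.
  apply/ffunP => v; rewrite ffunE [RHS]ffunE; case: ifP => // /stab_varpiP sv.
  apply/eqP; rewrite -[_ == _]negbK; apply/negP => nz; apply: nle.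
  have := Tb_support (@mincoset_uC _ D) (@inHpar_comp _ _ _ _ _) nz k.
  rewrite uC_hw => le; apply: leq_trans le (cnt_subset _ _).
  apply/subsetP => x /imsetP[y]; rewrite inE => yl ->.
  by rewrite /pc permM mem_uC sv (leq_trans yl).
by rewrite {1}/Kop Z (lin0 (proj1 (leftop_Tb t _))).
Qed.

Lemma PsiR_semistandard T : sorted (fun D E : {set 'I_n} => #|E| <= #|D|)%N T ->
  ~~ semistandard T -> PsiR T = 0.
Proof.
elim: T => [|C [|D T] IH] //= /andP[DC st]; rewrite negb_and => /orP[N|N].
  apply: NNPP => /(PsiR_cnt DC) /cnt_entry_le le.
  by rewrite le in N.
by rewrite [X in Kop t C X](IH st N) (lin0 (@lin_Kop _ _ t C)).
Qed.

(** Induction from the rightmost column. The tail [U] is arbitrary: it enters only through the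
    equality of two components at that column. *)
Lemma PsiR_rec a b U C T : b = a.+1 :> nat ->
  let C1 := last C T in
  a \notin C1 -> b \in C1 ->
  comp #|C1| (PsiR U) (sC a C1) = comp #|C1| (PsiR U) C1 ->
  PsiR ((C :: T) ++ U) =
    Tsgn t (sigb a C) a (PsiR (map (sC a) (C :: T) ++ U)) +
    \sum_(1 <= k < size (C :: T) | sigb a (colk (C :: T) k) != sigb a (colk (C :: T) k.+1))
       sc (sigma R a (colk (C :: T) k) * (1 - t)) (PsiR (Omega a k (C :: T) ++ U)).
Proof.
move=> ab; have sgE E : sigb a E = (a \in E) && (b \notin E).
  by rewrite /sigb -ab !inCE.
elim: T C => [|D T IH] C /= aC bC cE.
  (* With a single column the sum is empty and the sign is +1, so the operator is [Tbar a], coming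
     from [uC C = s_a uC (sC a C)]. *)
  rewrite big_geq // addr0 sgE (negbTE aC) /= /Tsgn.
  have N : (a \in C) != (b \in C) by rewrite bC (negbTE aC).
  have asc : ((uC (sC a C))^-1%g a < (uC (sC a C))^-1%g b)%N.
    rewrite (uC_sC ab N); have [-> ->] := inv_pc_sP (uC C) ab.
    by have := mem_inv_uC C a; have := mem_inv_uC C b; rewrite bC (negbTE aC); lia.
  rewrite /Kop card_sC -(Tb_asc ht _ ab asc) -/(PsiR U) cE.
  by rewrite (uC_sC ab N) pc_sPK.
rewrite -[LHS]/(Kop t C (PsiR ((D :: T) ++ U))).
rewrite (IH D aC bC cE) (linD _ _ (@lin_Kop _ _ t C)) (Kop_Tsgn ht _ _ _ ab) -!sgE.
rewrite (lin_sum _ _ _ (@lin_Kop _ _ t C)) -addrA; congr (_ + _).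
(* The last index compares [D] with [C] and is the correction from [Kop_Tsgn]; all others come from
   the induction hypothesis with [C] prepended. *)
rewrite [RHS]big_mkcond big_nat_recr //= -big_mkcond addrC; congr (_ + _).
  rewrite [LHS]big_nat_cond [RHS]big_nat_cond.
  apply: eq_big => [k|k /andP[/andP[k1 kT] _]].
    case: (boolP (1 <= k < _)%N) => //= /andP[k1 kT].
    by rewrite !(@colk_cons C (D :: T)) //= k1 ltnW.
  rewrite (linZ _ _ (@lin_Kop _ _ t C)) (@colk_cons C (D :: T)) ?k1 ?(ltnW kT) //.
  by rewrite (@Omega_cons _ C (D :: T)) // ltnW.
have -> : colk [:: C, D & T] (size T).+1 = D by rewrite colk_cons /= ?leqnn // /colk subnn.
have -> : colk [:: C, D & T] (size T).+2 = C by rewrite /colk subnn.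
by rewrite Omega_cons // -[(size T).+1]/(size (D :: T)) Omega_size.
Qed.

End Tableaux.

(** * Transfer of the three claims from [PsiR] to [Psi] *)

Theorem theorem6p2 (R : comUnitRingType) (t : R) (ht : t \is a GRing.unit)
  (n : nat) (T : seq {set 'I_n}) (hT : is_tensor T) :
  (* (a) *)
  (~~ semistandard T -> Psi t T = 0) /\
  (* (b) *)
  (highest_weight T -> Psi t T = one_ R (tshape T)) /\
  (* (c) *)
  (forall (mu : 'I_n -> nat) (j : nat),
     dominant mu -> (plen mu <= #|colk T 1|)%N ->
     semistandard (T ++ T0 mu) ->
     (j.+1 < n)%N -> ~~ inC (colk T 1) j -> inC (colk T 1) j.+1 ->
     let Sigma :=
       \sum_(1 <= k < size T | sigb j (colk T k) != sigb j (colk T k.+1))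
          sc (sigma R j (colk T k) * (1 - t)) (Psi t (Omega j k T ++ T0 mu)) in
     Psi t (T ++ T0 mu) =
       (if sigb j (colk T (size T))
        then mulH t (bT R (sP n j)) (Psi t (Omega j (size T) T ++ T0 mu))
        else mulH t (sc t (TwInv t (sP n j))) (Psi t (Omega j (size T) T ++ T0 mu)))
       + Sigma).
Proof.
case/andP: hT => /andP[T_gt0 _] sT; have T0n : T != [::] by case: T T_gt0 {sT}.
split; first by rewrite PsiE //; apply: PsiR_semistandard.
split; first by rewrite PsiE //; apply: PsiR_highest_weight.
move=> mu j _ pl ss jn aC bC.
have hj : (j < n)%N by apply: ltnW.
pose a := Ordinal hj; pose b := Ordinal jn.
have ab : b = a.+1 :> nat by [].
rewrite -[j]/(nat_of_ord a) in aC bC *; rewrite -ab in bC; rewrite !inCE in aC bC.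
case: T T_gt0 sT T0n pl ss aC bC => // C T _ _ _ pl ss aC bC Sigma.
have C1E : colk (C :: T) 1 = last C T by rewrite /colk subn1 nth_last.
rewrite C1E in pl aC bC.
have ssU : semistandard (last C T :: T0 mu).
  move: ss; rewrite /semistandard /= cat_path; case/andP => _.
  by case: (T0 mu).
have cE := stab_hw_comp t ab (highest_weight_T0 mu) (tshape_T0 ab pl ssU aC).
rewrite (mulH_bT_sP _ _ ab) (mulH_TwInv_sP ht _ ab) /Sigma.
have -> : colk (C :: T) (size (C :: T)) = C by rewrite /colk subnn.
rewrite Omega_size !PsiE // (PsiR_rec ht ab aC bC) ?cE ?(negbTE aC) ?bC //.
rewrite -/(Tsgn _ _ _ _); congr (_ + _); rewrite big_nat_cond [RHS]big_nat_cond.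
apply: eq_bigr => k /andP[/andP[k1 kT] _]; rewrite PsiE //.
by rewrite Omega_cons.
Qed.
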